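(* Let $n\ge 1$ and let $\theta=(\theta^{ij})$ be a complex skew-symmetric $n\times n$ matrix. The quantum determinant ${\det}_\theta\in\mathcal F_n^\theta$ is a $T$-eigenvector (i.e. a simultaneous eigenvector of $H_1,\dots,H_n$), and it is left and right permutable in $\mathcal F_n^\theta$, i.e. $({\det}_\theta)\,\mathcal F_n^\theta=\mathcal F_n^\theta\,({\det}_\theta)$.
   Context: Put $q_{ij}=\exp(\tfrac{\mathrm i}{2}\theta^{ij})$ and $Q_{ij;kl}=q_{ki}\,q_{jl}$ for $i,j,k,l\in\{1,\dots,n\}$. $\mathcal F_n^\theta$ is the unital associative $\mathbb C$-algebra generated by $g_{ij}$, $1\le i,j\le n$, with the relations $g_{ij}\,g_{kl}=Q_{ij;kl}^2\;g_{kl}\,g_{ij}$. (The coordinate algebra of the noncommutative variety $\mathrm{GL}_\theta(n)$ is its localization at the element ${\det}_\theta$ defined below.) Torus action: $T=(\mathbb C^\times)^n$ is the diagonal torus, with infinitesimal generators $H_1,\dots,H_n$ acting on $\mathcal F_n^\theta$ by derivations (the coproduct of $H_i$ is $H_i\otimes 1+1\otimes H_i$) determined by $H_i\triangleright g_{kl}=\delta_{il}\,g_{kl}$. Deformed Levi--Civita symbols: for $(i_1\cdots i_n)$ a permutation of $(1\cdots n)$, $$\epsilon_\theta^{i_1\cdots i_n\,(c)}=\mathrm{sgn}(i_1\cdots i_n)\prod_{k=1}^{n-1}\prod_{s=1}^{n-k}Q_{s+k\,i_{s+k}\,;\,k\,i_k},\qquad \epsilon_\theta^{i_1\cdots i_n\,(r)}=\mathrm{sgn}(i_1\cdots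 i_n)\prod_{k=1}^{n-1}\prod_{s=1}^{n-k}Q_{i_{s+k}\,s+k\,;\,i_k\,k},$$ and both symbols vanish if two indices coincide. The quantum determinant is $${\det}_\theta=\frac1{n!}\sum_{i_1,\dots,i_n}\ \sum_{j_1,\dots,j_n}\epsilon_\theta^{i_1\cdots i_n\,(r)}\,\epsilon_\theta^{j_1\cdots j_n\,(c)}\,g_{i_1j_1}\cdots g_{i_nj_n},$$ with products taken in $\mathcal F_n^\theta$. *)

(* Defs.v *)
From HB Require Import structures.
From mathcomp Require Import all_boot all_order all_algebra all_fingroup.
From mathcomp Require Import generic_quotient ring_quotient.
From mathcomp Require Import finmap complex monalg.
From mathcomp Require Import boolp classical_sets reals sequences exp trigo.

Set Implicit Arguments.
Unset Strict Implicit.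
Unset Printing Implicit Defensive.

Import Order.TTheory GRing.Theory Num.Theory.
Local Open Scope ring_scope.
Local Open Scope quotient_scope.

Inductive two_sided_ideal (A : nzRingType) (S : A -> Prop) : A -> Prop :=
| tsideal0 : two_sided_ideal S 0
| tsidealD a r b x :
    S r -> two_sided_ideal S x -> two_sided_ideal S (a * r * b + x).

Section IdealTheory.
Variables (A : nzRingType) (S : A -> Prop).
Local Notation I := (two_sided_ideal S).

Lemma tsideal_add x y : I x -> I y -> I (x + y).
Proof.
by move=> Ix Iy; elim: Ix => [|a r b z Sr _ IH]; rewrite ?add0r // -addrA; constructor.
Qed.

Lemma tsideal_mulr x c : I x -> I (x * c).
Proof.
elim=> [|a r b z Sr _ IH]; first by rewrite mul0r; constructor.
by rewrite mulrDl -mulrA; constructor.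
Qed.

Lemma tsideal_mull x c : I x -> I (c * x).
Proof.
elim=> [|a r b z Sr _ IH]; first by rewrite mulr0; constructor.
by rewrite mulrDr 2!mulrA; constructor.
Qed.

Lemma tsideal_opp x : I x -> I (- x).
Proof. by move=> Ix; rewrite -mulN1r; exact: tsideal_mull. Qed.

Lemma tsideal_mem r : S r -> I r.
Proof.
by move=> Sr; rewrite -[r]mulr1 -[r]mul1r -[_ * 1]addr0; do 2?constructor.
Qed.

End IdealTheory.

Section Leibniz.
Variables (A : nzRingType) (d : A -> A).
Hypotheses (d0 : d 0 = 0) (dD : forall x y, d (x + y) = d x + d y).

Lemma leibniz0l y : d (0 * y) = d 0 * y + 0 * d y.
Proof. by rewrite !mul0r d0 mul0r addr0. Qed.

Lemma leibniz0r x : d (x * 0) = d x * 0 + x * d 0.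
Proof. by rewrite !mulr0 d0 mulr0 addr0. Qed.

Lemma leibnizDl x x' y : d (x * y) = d x * y + x * d y ->
  d (x' * y) = d x' * y + x' * d y ->
  d ((x + x') * y) = d (x + x') * y + (x + x') * d y.
Proof. by move=> E E'; rewrite !(mulrDl, dD) E E' addrACA. Qed.

Lemma leibnizDr x y y' : d (x * y) = d x * y + x * d y ->
  d (x * y') = d x * y' + x * d y' ->
  d (x * (y + y')) = d x * (y + y') + x * d (y + y').
Proof. by move=> E E'; rewrite !(mulrDr, dD) E E' addrACA. Qed.

End Leibniz.

Lemma rmorph_rel0 (A S : nzRingType) (f : {rmorphism A -> S}) a b c x y t :
  f x = 0 -> f y = 0 -> f t = 0 ->
  f (a * (x * y - c * (y * x)) * b + t) = 0.
Proof.
move=> fx fy ft.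
by rewrite rmorphD !rmorphM rmorphB !rmorphM fx fy ft !(mul0r, mulr0, subr0, addr0).
Qed.

Lemma eigen_sub (K : nzRingType) (V : lmodType K) (d : V -> V) (a c : K) x y :
  (forall x y, d (x + y) = d x + d y) ->
  (forall c x, d (c *: x) = c *: d x) ->
  d x = a *: x -> d y = a *: y -> GRing.comm a c ->
  d (x - c *: y) = a *: (x - c *: y).
Proof.
move=> dD dZ dx dy ac.
by rewrite -scaleNr dD dZ dx dy scalerDr !scalerA mulNr mulrN ac.
Qed.

Lemma eigen_mul (K : nzRingType) (A : lalgType K) (d : A -> A) (a b : K) x y :
  (forall x y, d (x * y) = d x * y + x * d y) ->
  (forall c (x y : A), c *: (x * y) = x * (c *: y)) ->
  d x = a *: x -> d y = b *: y -> d (x * y) = (a + b) *: (x * y).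
Proof. by move=> dM ZAr dx dy; rewrite dM dx dy -scalerAl -ZAr scalerDl. Qed.

Notation freealg K n := {malg K[{fmonom ('I_n * 'I_n)%type}]}.

Section FreeAlgebra.
Variables (K : fieldType) (n : nat).
Local Notation word := {fmonom ('I_n * 'I_n)%type}.
Local Notation freealg := (freealg K n).

Definition free_gen (i j : 'I_n) : freealg := << fmu (i, j) >>.

Definition colcount (i : 'I_n) (w : word) : K :=
  (count (fun a : 'I_n * 'I_n => a.2 == i) w)%:R.

(* The derivation X_kl |-> delta_il X_kl of the free algebra multiplies a word
   by the number of its letters having second index i (see free_derM and
   free_der_gen). *)
Definition free_der (i : 'I_n) (x : freealg) : freealg :=
  \sum_(w <- msupp x) << colcount i w * x@_w *g w >>.

Lemma freealg_ind (P : freealg -> Prop) :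
  P 0 -> (forall x y, P x -> P y -> P (x + y)) ->
  (forall c w, P << c *g w >>) -> forall x, P x.
Proof.
by move=> P0 PD PU x; rewrite [x]monalgE; elim/big_ind: _ => // w _.
Qed.

Lemma free_der_coef i x w : (free_der i x)@_w = colcount i w * x@_w.
Proof.
rewrite {2}[x]monalgE !raddf_sum mulr_sumr; apply: eq_bigr => v _ /=.
by rewrite !mcoeffU; case: eqP => [->|_]; rewrite ?mulr1n // !mulr0n mulr0.
Qed.

Lemma free_derD i (x y : freealg) :
  free_der i (x + y) = free_der i x + free_der i y.
Proof.
apply/malgP => w; rewrite (free_der_coef i (x + y)) (mcoeffD w x y) mulrDr.
by rewrite (mcoeffD w (free_der i x)) (free_der_coef i x) (free_der_coef i y).
Qed.

Lemma free_der0 i : free_der i 0 = 0.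
Proof. by rewrite /free_der msupp0 big_seq_fset0. Qed.

Lemma free_derZ i (c : K) (x : freealg) :
  free_der i (c *: x) = c *: free_der i x.
Proof.
apply/malgP => w; have Z (z : freealg) : (c *: z)@_w = c * z@_w := mcoeffZ c z w.
apply: etrans (free_der_coef i (c *: x) w) _; rewrite Z mulrCA.
by apply: esym; apply: etrans (Z _) _; rewrite (free_der_coef i x).
Qed.

Lemma free_derU i (c : K) (w : word) :
  free_der i << c *g w >> = << colcount i w * c *g w >>.
Proof.
apply/malgP => v; rewrite free_der_coef !mcoeffU.
by case: eqP => [->|_]; rewrite ?mulr1n // !mulr0n mulr0.
Qed.

Lemma colcountM i (u v : word) :
  colcount i (mmul u v) = colcount i u + colcount i v.
Proof. by rewrite /colcount fmM count_cat natrD. Qed.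

Lemma malgUM (c d : K) (u v : word) :
  << c *g u >> * << d *g v >> = << c * d *g mmul u v >> :> freealg.
Proof. exact: fgmulUU. Qed.

Lemma free_derM i (x y : freealg) :
  free_der i (x * y) = free_der i x * y + x * free_der i y.
Proof.
elim/freealg_ind: x => [|x x' IH IH'|c u].
- exact: leibniz0l (free_der0 i) y.
- exact (@leibnizDl freealg (free_der i) (free_derD i) x x' y IH IH').
elim/freealg_ind: y => [|y y' IH IH'|d v].
- exact: leibniz0r (free_der0 i) _.
- exact (@leibnizDr freealg (free_der i) (free_derD i) _ y y' IH IH').
apply: etrans (congr1 (free_der i) (malgUM c d u v)) _.
rewrite (free_derU i (c * d)) (free_derU i c u) (free_derU i d v).
apply: etrans _ (esym (congr2 +%R (malgUM (colcount i u * c) d u v)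
                                   (malgUM c (colcount i v * d) u v))).
rewrite -(monalgUD (mmul u v)) colcountM mulrDl !mulrA.
by rewrite [c * colcount i v]mulrC.
Qed.

Lemma free_der_gen i k l :
  free_der i (free_gen k l) = (i == l)%:R *: free_gen k l.
Proof.
rewrite /free_gen (free_derU i 1) mulr1 /colcount fmU /= addn0 eq_sym.
case: eqP => _; first by rewrite scale1r.
by rewrite scale0r; exact: monalgU0.
Qed.

Lemma free_scalerAr c (x y : freealg) : c *: (x * y) = x * (c *: y).
Proof.
have comC (z : freealg) : c%:MP * z = z * c%:MP.
  elim/freealg_ind: z => [|z z' IH IH'|d u].
  - exact: etrans (mulr0 _) (esym (mul0r _)).
  - exact: etrans (mulrDr _ _ _) (etrans (congr2 _ IH IH') (esym (mulrDl _ _ _))).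
  by rewrite malgUM malgUM mulrC mul1m mulm1.
by rewrite -mul_malgC -(mul_malgC c y) mulrA comC mulrA.
Qed.

End FreeAlgebra.

(* qalg c is the unital associative K-algebra generated by g_ij, 1 <= i, j <= n,
   with the relations g_ij g_kl = c i j k l *: (g_kl g_ij), built as the quotient
   of the free algebra by the two-sided ideal generated by the relations. *)
Section QuotientAlgebra.
Variables (K : fieldType) (n : nat).
Variable c : 'I_n -> 'I_n -> 'I_n -> 'I_n -> K.
Local Notation A := (freealg K n).
Local Notation g := (@free_gen K n).

Definition qrel (r : A) : Prop :=
  exists i j k l, r = g i j * g k l - c i j k l *: (g k l * g i j).

Definition qideal : {pred A} := fun x => `[< two_sided_ideal qrel x >].

Lemma qideal_zmod : zmod_closed qideal.
Proof.
split; first by apply/asboolP; constructor.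
move=> x y /asboolP Ix /asboolP Iy; apply/asboolP.
by apply: tsideal_add => //; exact: tsideal_opp.
Qed.
HB.instance Definition _ := GRing.isZmodClosed.Build A qideal qideal_zmod.

Definition qalg := @Quotient.quot A qideal.
HB.instance Definition _ := EqQuotient.on qalg.
HB.instance Definition _ := GRing.Zmodule.on qalg.

Definition qproj (x : A) : qalg := \pi_qalg x.

Lemma qprojK (x : qalg) : qproj (repr x) = x.
Proof. exact: reprK. Qed.

Lemma qprojP x y : qproj x = qproj y <-> two_sided_ideal qrel (x - y).
Proof.
split=> [/eqP|I]; first by rewrite -Quotient.idealrBE => /asboolP.
by apply/eqP; rewrite -Quotient.idealrBE; apply/asboolP.
Qed.

Lemma qproj0 : qproj 0 = 0.
Proof. by rewrite /qproj !piE. Qed.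

Lemma qprojB x y : qproj (x - y) = qproj x - qproj y.
Proof. by rewrite /qproj !piE. Qed.

Lemma qprojD x y : qproj (x + y) = qproj x + qproj y.
Proof. by rewrite /qproj !piE. Qed.

Lemma repr_qproj x : two_sided_ideal qrel (repr (qproj x) - x).
Proof. by apply/qprojP; rewrite qprojK. Qed.

Definition qone : qalg := qproj 1.
Definition qmul (x y : qalg) : qalg := qproj (repr x * repr y).
Definition qscale (a : K) (x : qalg) : qalg := qproj (a *: repr x).

Lemma qprojM x y : qproj (x * y) = qmul (qproj x) (qproj y).
Proof.
apply/esym/qprojP.
have -> : repr (qproj x) * repr (qproj y) - x * y =
  (repr (qproj x) - x) * repr (qproj y) + x * (repr (qproj y) - y).
  by rewrite mulrBl mulrBr addrA addrNK.
by apply: tsideal_add; [apply: tsideal_mulr|apply: tsideal_mull]; exact: repr_qproj.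
Qed.

Lemma qprojZ a x : qproj (a *: x) = qscale a (qproj x).
Proof.
apply/esym/qprojP; rewrite -scalerBr -mul_malgC.
by apply: tsideal_mull; exact: repr_qproj.
Qed.

Lemma qalgP (P : qalg -> Prop) : (forall x, P (qproj x)) -> forall x, P x.
Proof. by move=> H x; rewrite -[x]qprojK. Qed.

Lemma qmulA : associative qmul.
Proof.
elim/qalgP=> x; elim/qalgP=> y; elim/qalgP=> z.
by rewrite -!qprojM mulrA.
Qed.

Lemma qmul1l : left_id qone qmul.
Proof. by elim/qalgP=> x; rewrite -qprojM mul1r. Qed.

Lemma qmul1r : right_id qone qmul.
Proof. by elim/qalgP=> x; rewrite -qprojM mulr1. Qed.

Lemma qmulDl : left_distributive qmul +%R.
Proof.
elim/qalgP=> x; elim/qalgP=> y; elim/qalgP=> z.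
by rewrite -qprojD -!qprojM -qprojD mulrDl.
Qed.

Lemma qmulDr : right_distributive qmul +%R.
Proof.
elim/qalgP=> x; elim/qalgP=> y; elim/qalgP=> z.
by rewrite -qprojD -!qprojM -qprojD mulrDr.
Qed.

(* The relations have no constant term. *)
Lemma qone_neq0 : qone != 0.
Proof.
apply/eqP => q10.
have /qprojP : qproj 1 = qproj 0 by rewrite qproj0.
rewrite subr0.
suff I0 (x : A) : two_sided_ideal qrel x ->
    mcoeff (mone : {fmonom ('I_n * 'I_n)%type}) x = 0.
  by move/I0 => /eqP; rewrite mcoeff1 eqxx oner_eq0.
elim=> [|a r b y [i [j [k [l ->]]]] _ IH]; first exact: mcoeff0.
have g0 p q : mcoeff (mone : {fmonom ('I_n * 'I_n)%type}) (g p q) = 0.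
  by rewrite mcoeffU; case: eqP => // /(congr1 (@fdeg _)); rewrite fdegU fdeg1.
rewrite -(mul_malgC (c i j k l)).
exact (@rmorph_rel0 A K (@mcoeff {fmonom ('I_n * 'I_n)%type} K mone)
         a b (c i j k l)%:MP _ _ y (g0 i j) (g0 k l) IH).
Qed.

HB.instance Definition _ := GRing.Zmodule_isNzRing.Build qalg
  qmulA qmul1l qmul1r qmulDl qmulDr qone_neq0.

Lemma qscaleA a b x : qscale a (qscale b x) = qscale (a * b) x.
Proof. by elim/qalgP: x => x; rewrite -!qprojZ scalerA. Qed.

Lemma qscale1 : left_id 1 qscale.
Proof. by elim/qalgP=> x; rewrite -qprojZ scale1r. Qed.

Lemma qscaleDr : right_distributive qscale +%R.
Proof.
move=> a; elim/qalgP=> x; elim/qalgP=> y.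
by rewrite -qprojD -!qprojZ -qprojD scalerDr.
Qed.

Lemma qscaleDl x : {morph qscale^~ x : a b / a + b}.
Proof.
by elim/qalgP: x => x a b; rewrite -!qprojZ -qprojD scalerDl.
Qed.

HB.instance Definition _ := GRing.Zmodule_isLmodule.Build K qalg
  qscaleA qscale1 qscaleDr qscaleDl.

Lemma qscaleAl a (x y : qalg) : a *: (x * y) = (a *: x) * y.
Proof.
elim/qalgP: x => x; elim/qalgP: y => y.
by rewrite -[LHS]/(qscale _ (qmul _ _)) -[RHS]/(qmul (qscale _ _) _)
  -!(qprojM, qprojZ) scalerAl.
Qed.

HB.instance Definition _ := GRing.Lmodule_isLalgebra.Build K qalg qscaleAl.

Lemma qscaleAr a (x y : qalg) : a *: (x * y) = x * (a *: y).
Proof.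
elim/qalgP: x => x; elim/qalgP: y => y.
by rewrite -[LHS]/(qscale _ (qmul _ _)) -[RHS]/(qmul _ (qscale _ _))
  -!(qprojM, qprojZ) free_scalerAr.
Qed.

HB.instance Definition _ := GRing.Lalgebra_isAlgebra.Build K qalg qscaleAr.

Lemma qproj_linear : linear qproj.
Proof. by move=> a x y; rewrite qprojD qprojZ. Qed.
Lemma qproj_monoid : monoid_morphism qproj.
Proof. split; [exact: erefl|exact: qprojM]. Qed.
HB.instance Definition _ := GRing.isLinear.Build K A qalg *:%R qproj qproj_linear.
HB.instance Definition _ := GRing.isMonoidMorphism.Build A qalg qproj qproj_monoid.

Definition qgen (i j : 'I_n) : qalg := qproj (g i j).

Lemma qgen_rel i j k l : qgen i j * qgen k l = c i j k l *: (qgen k l * qgen i j).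
Proof.
rewrite /qgen -!rmorphM -linearZ; apply/qprojP/tsideal_mem.
by exists i, j, k, l.
Qed.

(* The generator H_i of the torus action: the linear derivation determined by
   H_i g_kl = delta_il g_kl (torus_derM and torus_der_gen below). *)
Definition torus_der (i : 'I_n) (x : qalg) : qalg := qproj (free_der i (repr x)).

Lemma free_der_qideal i x :
  two_sided_ideal qrel x -> two_sided_ideal qrel (free_der i x).
Proof.
elim=> [|a r b y Sr _ IH]; first by rewrite free_der0; constructor.
rewrite free_derD; apply: tsideal_add _ IH.
rewrite (free_derM i (a * r) b) (free_derM i a r) (mulrDl (free_der i a * r)).
have Ir := tsideal_mem Sr.
apply: tsideal_add; last by apply: tsideal_mulr; apply: tsideal_mull.
apply: tsideal_add; first by apply: tsideal_mulr; apply: tsideal_mull.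
apply: tsideal_mulr; apply: tsideal_mull.
case: Sr Ir => p [q [k [l rE]]].
suff -> : free_der i r = ((i == q)%:R + (i == l)%:R) *: r.
  by rewrite -mul_malgC; exact: tsideal_mull.
rewrite rE; apply: (eigen_sub (free_derD i) (free_derZ i)); last exact: mulrC.
  by apply: eigen_mul (free_derM i) (@free_scalerAr K n) _ _;
    exact: free_der_gen.
rewrite [X in X *: _]addrC.
by apply: eigen_mul (free_derM i) (@free_scalerAr K n) _ _; exact: free_der_gen.
Qed.

Lemma torus_der_proj i x : torus_der i (qproj x) = qproj (free_der i x).
Proof.
apply/qprojP; rewrite -[free_der i x]scale1r -scaleNr -free_derZ -free_derD scaleN1r.
by apply: free_der_qideal; exact: repr_qproj.
Qed.

Lemma torus_der_linear i : linear (torus_der i).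
Proof.
move=> a; elim/qalgP=> x; elim/qalgP=> y.
apply: etrans (congr1 (torus_der i) (esym (qproj_linear a x y))) _.
apply: etrans (torus_der_proj i _) _; rewrite (free_derD i (a *: x)) (free_derZ i).
by apply: etrans (qproj_linear _ _ _) _; rewrite !torus_der_proj.
Qed.
HB.instance Definition _ i :=
  GRing.isLinear.Build K qalg qalg *:%R (torus_der i) (torus_der_linear i).

Lemma torus_derM i x y : torus_der i (x * y) = torus_der i x * y + x * torus_der i y.
Proof.
elim/qalgP: x => x; elim/qalgP: y => y.
apply: etrans (congr1 (torus_der i) (esym (qprojM x y))) _.
apply: etrans (torus_der_proj i _) _; rewrite (free_derM i x) qprojD.
apply: etrans (congr2 _ (qprojM _ _) (qprojM _ _)) _.
exact: esym (congr2 _ (congr1 (qmul^~ _) (torus_der_proj i x))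
                      (congr1 (qmul _) (torus_der_proj i y))).
Qed.

Lemma torus_der_gen i k l : torus_der i (qgen k l) = (i == l)%:R *: qgen k l.
Proof.
apply: etrans (torus_der_proj i _) _; rewrite free_der_gen.
exact: qprojZ.
Qed.

End QuotientAlgebra.

(* exp (x + i y) = e^x (cos y + i sin y) *)
Definition cexp (R : realType) (z : R[i]) : R[i] :=
  (expR (complex.Re z))%:C%C *
  Complex (cos (complex.Im z)) (sin (complex.Im z)).

(* Indices are 0-based: 'I_n stands for {1, ..., n}. *)
Section Scalars.
Variables (R : realType) (n : nat) (theta : 'M[R[i]]_n).

Definition qpar (i j : 'I_n) : R[i] := cexp ('i%C / 2 * theta i j).

Definition Qpar (i j k l : 'I_n) : R[i] := qpar k i * qpar j l.

(* 0 unless the index tuple i is a permutation. *)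
Definition sgn_tuple (i : {ffun 'I_n -> 'I_n}) : R[i] :=
  if insub i is Some s then (-1) ^+ (s : 'S_n) else 0.

(* The products run over the pairs k < m, with m = s + k. *)
Definition eps_c (i : {ffun 'I_n -> 'I_n}) : R[i] :=
  sgn_tuple i *
  \prod_(k < n) \prod_(m < n | (k < m)%N) Qpar m (i m) k (i k).

Definition eps_r (i : {ffun 'I_n -> 'I_n}) : R[i] :=
  sgn_tuple i *
  \prod_(k < n) \prod_(m < n | (k < m)%N) Qpar (i m) m (i k) k.

End Scalars.

(* The algebra F_n^theta. *)
Notation Ftheta theta := (qalg (fun i j k l => Qpar theta i j k l ^+ 2)).

Definition det_theta (R : realType) (n : nat) (theta : 'M[R[i]]_n) :
    Ftheta theta :=
  (n`!%:R)^-1 *: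
    \sum_(i : {ffun 'I_n -> 'I_n}) \sum_(j : {ffun 'I_n -> 'I_n})
      (eps_r theta i * eps_c theta j) *: \prod_(k < n) qgen _ (i k) (j k).

Definition torus_eigenvector (K : fieldType) (n : nat)
    (c : 'I_n -> 'I_n -> 'I_n -> 'I_n -> K) (x : qalg c) : Prop :=
  x != 0 /\ forall i : 'I_n, exists a : K, torus_der i x = a *: x.

Definition permutable (A : nzRingType) (x : A) : Prop :=
  (range (fun y => x * y) = range (fun y => y * x))%classic.

(* Main.v *)
From HB Require Import structures.
Require Import Defs.
From mathcomp Require Import all_boot all_algebra complex reals.
From mathcomp Require Import all_fingroup generic_quotient finmap monalg.
From mathcomp Require Import boolp classical_sets exp trigo.
Import GRing.Theory Num.Theory.
Local Open Scope ring_scope.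

Set Implicit Arguments.
Unset Strict Implicit.
Unset Printing Implicit Defensive.

(** The quantum determinant is a linear combination of the monomials
    [g_{i_1 j_1} ... g_{i_n j_n}], where only the pairs of permutations [i], [j]
    have a nonzero coefficient ([eps_inj]).  All these monomials carry the same
    weights, and this gives both claims.

    Torus action.  [H_k] multiplies such a monomial by the number of [m] with
    [j_m = k] ([derivation_prod]), and this number is 1 because [j] is a
    permutation.  Hence [H_k] fixes the determinant ([torus_der_det]).

    Permutability.  Moving [g_{kl}] from the right of such a monomial to its left
    produces the scalar [prod_m Q_{i_m j_m; k l}^2].  This scalar splits into
    [prod_m q_{k i_m}^2] times [prod_m q_{j_m l}^2], so it does not depend on the
    permutations [i] and [j] ([prod_Qpar]).  Therefore the determinant commutes
    with each generator up to a nonzero scalar ([det_theta_qcomm]); as the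
    generators generate the algebra, left and right multiples of the determinant
    coincide ([permutable_of_qcomm]).

    Nonvanishing.  It suffices to exhibit a character whose value at the
    determinant is nonzero.  The diagonal generators commute with each other
    because [q_{ki} q_{ik} = 1], so the relations allow a character sending
    [g_{ij}] to [delta_{ij}] ([counit_exists]).  It kills the monomials with
    [i <> j].  When [i = j] is a permutation, the two deformed
    symbols are inverse to each other ([eps_rc]) and the monomial contributes 1.
    So the character maps the determinant to [n! / n! = 1] ([det_theta_neq0]). *)

(** * Multiplication and derivation of monomials in an algebra *)

Section Generation.
Variables (K : fieldType) (A : algType K) (I : Type) (u : I -> A).

(** Generation is expressed as an induction principle: every element is reached
    from 1 by linear combinations and left multiplications by generators. *)
Definition alg_generated := forall P : A -> Prop,
  P 1 -> (forall x y, P x -> P y -> P (x + y)) ->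
  (forall a x, P x -> P (a *: x)) -> (forall i x, P x -> P (u i * x)) ->
  forall x, P x.

(** The elements [y] such that [x * y] is a left multiple of [x] form a
    subalgebra, and so do those such that [y * x] is a right multiple of [x];
    both contain the generators because the [lam i] are invertible. *)
Lemma permutable_of_qcomm (x : A) (lam : I -> K) : alg_generated ->
  (forall i, lam i != 0) -> (forall i, x * u i = lam i *: (u i * x)) ->
  permutable x.
Proof.
move=> gen lam0 xu; apply/seteqP; split=> _ [y _ <-] /=.
  have [z ->] : exists z, x * y = z * x; last by exists z.
  elim/gen: y => [|y y' [z E] [z' E']|a y [z E]|i y [z E]].
  - by exists 1; rewrite mulr1 mul1r.
  - by exists (z + z'); rewrite mulrDr mulrDl E E'.
  - by exists (a *: z); rewrite -scalerAr -scalerAl E.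
  by exists (lam i *: (u i * z)); rewrite mulrA xu -!scalerAl -!mulrA E.
have [z ->] : exists z, y * x = x * z; last by exists z.
elim/gen: y => [|y y' [z E] [z' E']|a y [z E]|i y [z E]].
- by exists 1; rewrite mulr1 mul1r.
- by exists (z + z'); rewrite mulrDr mulrDl E E'.
- by exists (a *: z); rewrite -scalerAr -scalerAl E.
exists ((lam i)^-1 *: (u i * z)).
by rewrite -mulrA E -scalerAr !mulrA xu -scalerAl scalerA mulVf ?scale1r.
Qed.

End Generation.

Section Monomials.
Variables (K : fieldType) (A : algType K).

Lemma prod_qcomm (I : Type) (s : seq I) (u : I -> A) (v : A) (a : I -> K) :
  (forall m, u m * v = a m *: (v * u m)) ->
  \prod_(m <- s) u m * v = (\prod_(m <- s) a m) *: (v * \prod_(m <- s) u m).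
Proof.
move=> uv; elim: s => [|m s IH]; first by rewrite !big_nil scale1r mul1r mulr1.
by rewrite !big_cons -mulrA IH -scalerAr !mulrA uv -scalerAl scalerA mulrC.
Qed.

Lemma derivation1 (d : A -> A) :
  (forall x y, d (x * y) = d x * y + x * d y) -> d 1 = 0.
Proof.
move=> dM; have := dM 1 1; rewrite !mulr1 mul1r => /eqP.
by rewrite -subr_eq subrr eq_sym => /eqP.
Qed.

Lemma derivation_prod (d : A -> A) (I : Type) (s : seq I) (u : I -> A)
    (a : I -> K) :
  (forall x y, d (x * y) = d x * y + x * d y) ->
  (forall m, d (u m) = a m *: u m) ->
  d (\prod_(m <- s) u m) = (\sum_(m <- s) a m) *: \prod_(m <- s) u m.
Proof.
move=> dM du; elim: s => [|m s IH].
  by rewrite !big_nil scale0r derivation1.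
by rewrite !big_cons dM du IH scalerDl -scalerAl -scalerAr.
Qed.

End Monomials.

(** * Linear combinations of vectors of the same weight *)

Section Combinations.
Variables (K : fieldType) (A : algType K) (I J : finType).
Variables (a : K) (b : I -> J -> K) (w : I -> J -> A).

(** Only the vectors with a nonzero coefficient matter: for the determinant these
    are the monomials indexed by permutations. *)
Lemma comb_ind (P : A -> Prop) :
  P 0 -> (forall x y, P x -> P y -> P (x + y)) ->
  (forall k x, P x -> P (k *: x)) ->
  (forall i j, b i j != 0 -> P (w i j)) ->
  P (a *: \sum_i \sum_j b i j *: w i j).
Proof.
move=> P0 PD PZ Pw; apply: (PZ a).
apply: big_ind => // i _; apply: big_ind => // j _.
by case: (eqVneq (b i j) 0) => [->|/Pw]; [rewrite scale0r|exact: PZ].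
Qed.

Lemma comb_qcomm (v : A) (lam : K) :
  (forall i j, b i j != 0 -> w i j * v = lam *: (v * w i j)) ->
  (a *: \sum_i \sum_j b i j *: w i j) * v =
  lam *: (v * (a *: \sum_i \sum_j b i j *: w i j)).
Proof.
move=> wv; apply: (comb_ind (P := fun x => x * v = lam *: (v * x))) =>
  // [|x y Ex Ey|k x Ex].
- by rewrite mul0r mulr0 scaler0.
- by rewrite mulrDl mulrDr scalerDr Ex Ey.
by rewrite -scalerAl -scalerAr Ex !scalerA mulrC.
Qed.

Lemma comb_eigen (d : A -> A) (lam : K) : linear d ->
  (forall i j, b i j != 0 -> d (w i j) = lam *: w i j) ->
  d (a *: \sum_i \sum_j b i j *: w i j) =
  lam *: (a *: \sum_i \sum_j b i j *: w i j).
Proof.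
move=> dlin dw.
have d0 : d 0 = 0 by have := dlin (-1) 0 0; rewrite scaler0 addr0 scaleN1r addNr.
apply: (comb_ind (P := fun x => d x = lam *: x)) => // [|x y Ex Ey|k x Ex].
- by rewrite scaler0.
- by have := dlin 1 x y; rewrite !scale1r scalerDr Ex Ey.
by have := dlin k x 0; rewrite !addr0 d0 addr0 Ex !scalerA mulrC.
Qed.

Lemma comb_scalar (e : A -> K) : scalar e ->
  e (a *: \sum_i \sum_j b i j *: w i j) =
  a * \sum_i \sum_j b i j * e (w i j).
Proof.
move=> elin; have e0 : e 0 = 0.
  by have := elin (-1) 0 0; rewrite scaler0 addr0 mulN1r addNr.
have eZ k x : e (k *: x) = k * e x by have := elin k x 0; rewrite !addr0 e0 addr0.
have eD x y : e (x + y) = e x + e y by have := elin 1 x y; rewrite scale1r mul1r.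
rewrite eZ (big_morph e eD e0); congr (_ * _); apply: eq_bigr => i _.
by rewrite (big_morph e eD e0); apply: eq_bigr => j _.
Qed.

End Combinations.

(** * Generators and characters of a quantum affine space *)

Lemma rmorph_ideal0 (A S : nzRingType) (f : {rmorphism A -> S})
    (r : A -> Prop) x : (forall y, r y -> f y = 0) ->
  two_sided_ideal r x -> f x = 0.
Proof.
move=> f0; elim=> [|a y b z ry _ IH]; first exact: rmorph0.
by rewrite rmorphD !rmorphM (f0 _ ry) mulr0 mul0r add0r.
Qed.

Lemma rmorph_qrel0 (K : fieldType) (A : lalgType K) (f : {rmorphism A -> K})
    (a b b' : K) (x y : A) : (forall k z, f (k *: z) = k * f z) ->
  f x = b -> f y = b' -> b * b' = a * (b * b') -> f (x * y - a *: (y * x)) = 0.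
Proof.
by move=> fZ fx fy E; rewrite rmorphB fZ !rmorphM fx fy [b' * _]mulrC -E subrr.
Qed.

Section QuantumAffineSpace.
Variables (K : fieldType) (n : nat).
Variable c : 'I_n -> 'I_n -> 'I_n -> 'I_n -> K.
Local Notation F := (qalg c).
Local Notation g := (qgen c).
Local Notation word := {fmonom ('I_n * 'I_n)%type}.

Lemma qgen_generates : alg_generated (A := F) (fun a => g a.1 a.2).
Proof.
move=> P P1 PD PZ PM; elim/qalgP => x; elim/freealg_ind: x => [|x y Px Py|a w].
- by rewrite qproj0 -(scale0r 1); exact: PZ.
- by rewrite qprojD; exact: PD.
have -> : << a *g w >> = a *: << w >> :> freealg K n.
  by rewrite -mul_malgC malgUM mulr1 mul1m.
rewrite qprojZ; apply: (PZ a); case: w => s; elim: s => [|[i j] s IH].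
  by rewrite -fmE -/(fmone _).
have -> : << FMonom ((i, j) :: s) >> =
    free_gen K i j * << FMonom s >> :> freealg K n.
  by rewrite malgUM mulr1; congr << _ >>; apply/val_inj; rewrite /= fmM fmU.
by rewrite qprojM; exact: (PM (i, j)).
Qed.

Lemma qalg_mul_gen (I : Type) (s : seq I) (i j : I -> 'I_n) k l :
  \prod_(m <- s) g (i m) (j m) * g k l =
  (\prod_(m <- s) c (i m) (j m) k l) *: (g k l * \prod_(m <- s) g (i m) (j m)).
Proof.
exact: (@prod_qcomm K F I s _ _ _ (fun m => qgen_rel c (i m) (j m) k l)).
Qed.

Lemma torus_der_monomial (I : Type) (s : seq I) (i j : I -> 'I_n) k :
  torus_der k (\prod_(m <- s) g (i m) (j m)) =
  (\sum_(m <- s) (k == j m)%:R) *: \prod_(m <- s) g (i m) (j m).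
Proof.
exact: (@derivation_prod K F _ I s _ _ (torus_derM k)
         (fun m => torus_der_gen c k (i m) (j m))).
Qed.

(** The counit of the matrix bialgebra, [X_ij |-> delta_ij], is first defined on
    the words and then extended linearly to the free algebra. *)
Definition word_counit (w : word) : K := \prod_(a <- w) (a.1 == a.2)%:R.

Lemma word_counit_is_mmorphism : mmorphism word_counit.
Proof.
split=> [u v|]; rewrite /word_counit; first by rewrite fmM big_cat.
by rewrite fm1 big_nil.
Qed.

HB.instance Definition _ :=
  isMultiplicative.Build _ _ word_counit word_counit_is_mmorphism.

Definition free_counit : freealg K n -> K := mmap idfun word_counit.

HB.instance Definition _ := GRing.RMorphism.on free_counit.

Lemma free_counit_gen i j : free_counit (free_gen K i j) = (i == j)%:R.
Proof. by rewrite /free_counit mmapU mul1r /word_counit fmU big_seq1. Qed.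

(** Both terms of a relation are mapped to 0 unless its two generators are
    diagonal, and the hypothesis makes the diagonal generators commute. *)
Lemma free_counit_ideal x : (forall i k, c i i k k = 1) ->
  two_sided_ideal (qrel c) x -> free_counit x = 0.
Proof.
move=> c1; apply: (rmorph_ideal0 (f := free_counit)).
move=> _ [i [j [k [l ->]]]]; apply: (rmorph_qrel0 (f := free_counit)).
- exact: mmapZ.
- exact: free_counit_gen.
- exact: free_counit_gen.
case: (eqVneq i j) => [<-|_]; last by rewrite !mul0r mulr0.
case: (eqVneq k l) => [<-|_]; last by rewrite !mulr0.
by rewrite c1 mul1r.
Qed.

Lemma counit_exists : (forall i k, c i i k k = 1) ->
  exists e : F -> K, [/\ scalar e, monoid_morphism e &
    forall i j, e (g i j) = (i == j)%:R].
Proof.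
move=> c1; pose e (x : F) := free_counit (repr x).
have eE x : e (qproj c x) = free_counit x.
  apply/eqP; rewrite -subr_eq0; apply/eqP.
  apply: etrans (esym (mmapB _ _)) _.
  by apply: free_counit_ideal c1 _; exact: repr_qproj.
exists e; split=> [a| |i j].
- elim/qalgP=> x; elim/qalgP=> y.
  apply: etrans (congr1 e (esym (qproj_linear c a x y))) _.
  by rewrite !eE /free_counit mmapD mmapZ.
- split; first by apply: etrans (eE 1) _; exact: mmap1.
  elim/qalgP=> x; elim/qalgP=> y.
  apply: etrans (congr1 e (esym (qprojM c x y))) _.
  by rewrite !eE; exact: rmorphM.
by apply: etrans (eE _) _; exact: free_counit_gen.
Qed.

End QuantumAffineSpace.

(** * The deformed symbols *)

Section Scalars.
Variables (R : realType) (n : nat) (theta : 'M[R[i]]_n).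

Lemma cexpMN (z : R[i]) : cexp z * cexp (- z) = 1.
Proof.
case: z => x y; rewrite /cexp /=.
rewrite mulrACA -rmorphM /= -expRD subrr expR0 mul1r cosN sinN.
apply/eqP; rewrite eq_complex /= mulrN opprK -!expr2 cos2Dsin2 eqxx /=.
by rewrite mulrN mulrC addNr.
Qed.

Lemma qpar_neq0 i j : qpar theta i j != 0.
Proof.
have := cexpMN ('i%C / 2 * theta i j); rewrite -/(qpar theta i j).
by apply: contra_eq_neq => ->; rewrite mul0r eq_sym oner_eq0.
Qed.

Lemma sgn_tuple_inj (i : {ffun 'I_n -> 'I_n}) :
  sgn_tuple R i != 0 -> injective i.
Proof. by rewrite /sgn_tuple; case: insubP => [s /injectiveP|]; rewrite ?eqxx. Qed.

Lemma sum_sgn_tuple2 :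
  \sum_(i : {ffun 'I_n -> 'I_n}) sgn_tuple R i ^+ 2 = n`!%:R.
Proof.
have -> : n`!%:R = #|[pred i : {ffun 'I_n -> 'I_n} | injectiveb i]|%:R :> R[i].
  by rewrite -card_Sn -(card_sub {perm 'I_n}).
(* the squared sign is the indicator function of the permutations *)
rewrite -sum1_card natr_sum [RHS]big_mkcond /=; apply: eq_bigr => i _.
rewrite inE /sgn_tuple; case: insubP => [s -> _|/negPf ->]; last by rewrite expr0n.
by rewrite -exprM muln2 -mul2n exprM sqrrN expr1n expr1n.
Qed.

Lemma qpar_skew : theta^T = - theta ->
  forall i j, qpar theta i j * qpar theta j i = 1.
Proof.
move=> sk i j; have -> : qpar theta j i = cexp (- ('i%C / 2 * theta i j)).
  by have := congr1 (fun M : 'M_n => M i j) sk; rewrite /qpar !mxE -mulrN => <-.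
exact: cexpMN.
Qed.

(** For a pair [k < m] the row symbol has the factor [q_{i_k i_m} q_{m k}] and
    the column symbol the factor [q_{k m} q_{i_m i_k}]; these cancel because
    [q_{ij} q_{ji} = 1] for a skew-symmetric [theta]. *)
Lemma eps_rc : theta^T = - theta -> forall i,
  eps_r theta i * eps_c theta i = sgn_tuple R i ^+ 2.
Proof.
move=> sk i; rewrite /eps_r /eps_c mulrACA -expr2 -big_split /=.
rewrite big1 ?mulr1 // => k _; rewrite -big_split /= big1 // => m _.
by rewrite /Qpar [qpar _ k m * _]mulrC mulrACA !qpar_skew // mulr1.
Qed.

Lemma eps_inj i j : eps_r theta i * eps_c theta j != 0 ->
  injective i /\ injective j.
Proof.
rewrite !mulf_eq0 !negb_or => /andP[/andP[i0 _] /andP[j0 _]].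
by split; exact: sgn_tuple_inj.
Qed.

(** The scalar by which [g_kl] commutes with the monomial indexed by [i] and [j]
    separates the two index tuples, so each may be reordered on its own. *)
Lemma prod_Qpar (i j : 'I_n -> 'I_n) k l : injective i -> injective j ->
  \prod_m Qpar theta (i m) (j m) k l ^+ 2 = \prod_m Qpar theta m m k l ^+ 2.
Proof.
move=> ii ij; rewrite !prodrXl; congr (_ ^+ 2).
(* qpar is generalized because it unfolds to a product, in which big_split
   would continue to split *)
rewrite /Qpar; move: (qpar theta) => q; rewrite !big_split /=.
by rewrite [in RHS](reindex_inj ii) [X in _ = _ * X](reindex_inj ij).
Qed.

End Scalars.

(** * The quantum determinant *)

Section Det.
Variables (R : realType) (n : nat) (theta : 'M[R[i]]_n).

Lemma det_theta_neq0 : theta^T = - theta -> det_theta theta != 0.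
Proof.
move=> sk.
have c1 i k : Qpar theta i i k k ^+ 2 = 1 by rewrite /Qpar qpar_skew ?expr1n.
have [e [elin [e1 eM] eg]] :=
  counit_exists (c := fun i j k l => Qpar theta i j k l ^+ 2) c1.
suff eD : e (det_theta theta) = 1.
  apply: contra_eq_neq eD => ->; rewrite eq_sym.
  have := elin (-1) 0 0; rewrite scaler0 addr0 mulN1r addNr => ->.
  exact: oner_neq0.
apply: etrans (comb_scalar _ _ _ elin) _.
have eP (i j : {ffun 'I_n -> 'I_n}) :
    e (\prod_(k < n) qgen _ (i k) (j k)) = (i == j)%:R.
  rewrite (big_morph e eM e1); under eq_bigr do rewrite eg.
  case: (eqVneq i j) => [->|ij]; first by rewrite big1 // => k _; rewrite eqxx.
  have /existsP[k nk] : [exists k, i k != j k].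
    apply: contraNT ij => /existsPn eq_ij; apply/eqP/ffunP => k; apply/eqP.
    by have := eq_ij k; rewrite negbK.
  by rewrite (bigD1 k) //= (negPf nk) mul0r.
under eq_bigr => i _ do under eq_bigr => j _ do rewrite eP.
have diag i :
    \sum_j eps_r theta i * eps_c theta j * (i == j)%:R = sgn_tuple R i ^+ 2.
  rewrite (bigD1 i) //= eqxx mulr1 eps_rc // big1 ?addr0 // => j.
  by rewrite eq_sym => /negPf ->; rewrite mulr0.
under eq_bigr do rewrite diag.
by rewrite sum_sgn_tuple2 mulVf // pnatr_eq0 -lt0n fact_gt0.
Qed.

Lemma det_theta_qcomm k l :
  det_theta theta * qgen _ k l =
  (\prod_m Qpar theta m m k l ^+ 2) *: (qgen _ k l * det_theta theta).
Proof.
apply: comb_qcomm => i j /eps_inj[ii ij].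
by rewrite -(prod_Qpar theta k l ii ij); exact: qalg_mul_gen.
Qed.

Lemma torus_der_det k : torus_der k (det_theta theta) = 1 *: det_theta theta.
Proof.
apply: (@comb_eigen _ (Ftheta theta) _ _ _ _ _ (torus_der k) 1
         (torus_der_linear k)).
move=> i j /eps_inj[_ ij].
apply: etrans (torus_der_monomial _ _ _ _ _) _; congr (_ *: _).
transitivity (\sum_m (k == m)%:R : R[i]); first exact/esym/(reindex_inj ij).
by rewrite (bigD1 k) //= eqxx big1 ?addr0 // => m /negPf; rewrite eq_sym => ->.
Qed.

End Det.

Theorem theorem2p19 (R : realType) (n : nat) (theta : 'M[R[i]]_n)
    (n_ge1 : (1 <= n)%N) (theta_skew : theta^T = - theta) :
  torus_eigenvector (det_theta theta) /\ permutable (det_theta theta).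
Proof.
split.
  split=> [|k]; first exact: det_theta_neq0.
  by exists 1; exact: torus_der_det.
apply: (permutable_of_qcomm (A := Ftheta theta) (@qgen_generates _ _ _) _
         (fun a => det_theta_qcomm theta a.1 a.2)) => a.
by apply/prodf_neq0 => m _; rewrite expf_neq0 // mulf_neq0 ?qpar_neq0.
Qed.
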